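(* Let $e\in\mathbb{Z}$ with $e\notin\{-1,0,1\}$, let $n\geq 3$ be an integer, and let $r\geq 2$ be a divisor of $n$ such that $r\mid e^{n/r}-1$. Then for any cyclic permutation $\alpha\in\mathrm{S}_n$ of length $n$ (say $\alpha=(1,2,\ldots,n)$) the equation $\alpha\circ y\circ\alpha^{-1}=y^{e}$ has a non-trivial solution $y\in\mathrm{S}_n$, $y\neq 1$, such that each cycle of $y$ is of length $r$ and $y^{r}=1$. If $e=2$, then $n=6,20,21,60$ are examples of such integers, with $3\mid 2^{6/3}-1$, $5\mid 2^{20/5}-1$, $7\mid 2^{21/7}-1$ and $15\mid 2^{60/15}-1$. If $e=-2$, then $n=55$ is an example of such an integer, with $11\mid(-2)^{55/11}-1$.
   Context: $\mathrm{S}_n$ is the symmetric group of all bijections $\{1,2,\ldots,n\}\to\{1,2,\ldots,n\}$ under composition $\circ$, and $1$ denotes its identity. *)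

(* Defs.v *)
From mathcomp Require Import all_boot all_order all_algebra all_fingroup.

Set Implicit Arguments.
Unset Strict Implicit.
Unset Printing Implicit Defensive.

(* MathComp composes permutations left to right, (s * t)%g x = t (s x);
   s \oS t is the composition of maps, right to left. *)
Definition perm_comp (T : finType) (s t : {perm T}) : {perm T} := (t * s)%g.

Notation "s \oS t" := (perm_comp s t) (at level 50, left associativity).

Lemma perm_compE (T : finType) (s t : {perm T}) : s \oS t =1 s \o t.
Proof. by move=> x; rewrite permM. Qed.

Definition expgz (gT : finGroupType) (x : gT) (e : int) : gT :=
  match e with
  | Posz k => (x ^+ k)%g
  | Negz k => (x ^- k.+1)%g   (* Negz k is the integer - k.+1 *)
  end.

(* alpha = (s_1, s_2, ..., s_k); recall that next s fixes the points
   outside s. *)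
Definition cyclic_perm (T : finType) (k : nat) (alpha : {perm T}) : Prop :=
  exists s : seq T, [/\ size s = k, uniq s & alpha =1 next s].

(* The elements of porbits y include the singletons of the fixed points of y,
   so fixed points count as cycles of length 1. *)
Definition all_cycles_of_length (T : finType) (r : nat) (y : {perm T}) : Prop :=
  forall C : {set T}, C \in porbits y -> #|C| = r.

Definition admissible (e : int) (n r : nat) : Prop :=
  [/\ e \notin [:: (-1)%R; 0%R; 1%R],
      3 <= n,
      2 <= r,
      r %| n
    & (r%:Z %| e ^+ (n %/ r)%N - 1)%Z%R].

(* Main.v *)
Require Import Defs.
From mathcomp Require Import all_boot all_order all_algebra all_fingroup.
From mathcomp Require Import cyclic.

(** Number the points along the n-cycle alpha by 0, ..., n-1 and put m = n/r,
    u = alpha^m.  The power u preserves the classes of positions mod m and acts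
    on each of them as a single r-cycle.  Let y act on the class of j < m as
    u^(e^(m-1-j)).  Conjugation by alpha shifts the classes by one, so the
    equation asks that the exponent on class j be e times the one on class j+1;
    at the wrap-around from m-1 to 0 this needs e^m = 1 mod r, which also makes
    all the exponents coprime to r. *)

Lemma modnS_wrap (m k : nat) :
  0 < m -> k.+1 %% m = if (k %% m).+1 < m then (k %% m).+1 else 0.
Proof.
move=> m_gt0; rewrite -addn1 -modnDml addn1.
have [lt | le] := ltnP; first by rewrite modn_small.
by have /eqP-> : (k %% m).+1 == m; rewrite ?modnn // eqn_leq le ltn_pmod.
Qed.

(** This turns [alpha] into translation by 1 on the residues mod [#|T|], so that the rest is modular
    arithmetic. *)
Lemma cyclic_perm_position (T : finType) (alpha : {perm T}) :
  cyclic_perm #|T| alpha ->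
  exists2 pos : T -> nat, injective pos
    & forall k x, pos ((alpha ^+ k)%g x) = (pos x + k) %% #|T|.
Proof.
case=> s [sz_s uniq_s alphaE].
have s_all x : x \in s.
  have /subset_cardP : #|s| = #|T| by rewrite (card_uniqP uniq_s).
  by rewrite subset_predT => /(_ isT) ->.
have pos_lt x : index x s < #|T| by rewrite -sz_s index_mem.
have pos_next x : index (alpha x) s = (index x s).+1 %% #|T|.
  rewrite alphaE next_nth s_all.
  have := pos_lt x; rewrite -sz_s.
  move: uniq_s; case: {s_all pos_lt alphaE sz_s} s => // z p uniq_s.
  set i := index x _; rewrite [size _]/= ltnS leq_eqVlt => /orP[/eqP-> | lt_ip].
    (* At the last entry [nth] falls off [p] and returns its default, the head [z], which is the
       wrap-around. *)
    by rewrite nth_default // modnn /= eqxx.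
  by rewrite modn_small // -[nth z p i]/(nth z (z :: p) i.+1) index_uniq.
exists (index^~ s) => [x y | k x].
  by apply: (index_inj x).
elim: k => [|k IHk]; first by rewrite expg0 perm1 addn0 modn_small.
by rewrite expgSr permM pos_next IHk -addn1 modnDml addn1 addnS.
Qed.

(** A natural exponent suffices: once [y ^+ r = 1], an integer exponent matters only mod [r]. *)
Lemma conjugate_power_solution (T : finType) (alpha : {perm T}) (e r : nat) :
    cyclic_perm #|T| alpha -> 0 < #|T| -> r %| #|T| ->
    e ^ (#|T| %/ r) = 1 %[mod r] ->
  exists y : {perm T},
    [/\ (y ^ alpha = y ^+ e)%g, all_cycles_of_length r y & (y ^+ r = 1)%g].
Proof.
case/cyclic_perm_position=> pos pos_inj posX n_gt0 r_dv_n.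
set n := #|T| in posX n_gt0 r_dv_n *; set m := n %/ r => em1.
have nE : n = m * r by rewrite divnK.
have /andP[m_gt0 r_gt0] : (0 < m) && (0 < r) by rewrite -muln_gt0 -nE.
have pos_lt x : pos x < n.
  by have := posX 0 x; rewrite expg0 perm1 addn0 => ->; rewrite ltn_pmod.
have alphaX_fix k x : ((alpha ^+ k)%g x == x) = (n %| k).
  rewrite -(inj_eq pos_inj) posX -[X in _ == X](modn_small (pos_lt x)).
  by rewrite -[X in _ == X %% _]addn0 eqn_modDl mod0n.
have alpha_n : (alpha ^+ n = 1)%g.
  by apply/permP=> x; rewrite perm1; apply/eqP; rewrite alphaX_fix.
have alphaX_mod a b : a = b %[mod r] -> (alpha ^+ (m * a) = alpha ^+ (m * b))%g.
  move=> ab; rewrite -(expg_mod (m * a) alpha_n) -(expg_mod (m * b) alpha_n).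
  by rewrite nE -!muln_modr ab.
(* Residues mod [m] are at most [m.-1], so the truncated subtraction is exact. *)
pose c x := e ^ (m.-1 - pos x %% m).
pose f x := (alpha ^+ (m * c x))%g x.
have c_invariant a x : c ((alpha ^+ (m * a))%g x) = c x.
  rewrite /c posX modn_dvdm; last by rewrite nE dvdn_mulr.
  by rewrite addnC mulnC modnMDl.
have iter_f k x : iter k f x = (alpha ^+ (m * (c x * k)))%g x.
  elim: k => [|k IHk]; first by rewrite !muln0 perm1.
  rewrite iterS IHk /f c_invariant -permM -expgD -mulnDr.
  by rewrite mulnS addnC.
have iter_f_r x : iter r f x = x.
  by rewrite iter_f; apply/eqP; rewrite alphaX_fix nE mulnA dvdn_pmul2r ?dvdn_mulr.
(* The iterate [iter r f] is the identity and factors through [f]. *)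
have f_inj : injective f.
  move=> x1 x2 eq_f; rewrite -(iter_f_r x1) -(iter_f_r x2).
  by rewrite -(prednK r_gt0) !iterSr eq_f.
pose y := perm f_inj.
have yX k x : (y ^+ k)%g x = (alpha ^+ (m * (c x * k)))%g x.
  by rewrite permX -iter_f; apply: eq_iter => z; rewrite permE.
have y_r : (y ^+ r = 1)%g.
  by apply/permP=> x; rewrite permX perm1 -[RHS]iter_f_r;
    apply: eq_iter => z; rewrite permE.
have c_coprime x : coprime r (c x).
  have : coprime (e ^ m) r by rewrite -coprime_modl em1 coprime_modl coprime1n.
  by rewrite coprime_pexpl // coprime_sym; apply: coprimeXr.
have c_alpha x : c x = c (alpha x) * e %[mod r].
  rewrite /c -expnSr.
  have -> : pos (alpha x) = (pos x).+1 %% n.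
    by rewrite -[in LHS](expg1 alpha) posX addn1.
  rewrite modn_dvdm; last by rewrite nE dvdn_mulr.
  rewrite modnS_wrap //.
  case: ltnP => [lt_m | ge_m].
    by rewrite subnSK // -ltnS prednK.
  (* Wrap-around: the exponents are [e ^ 0] at [x] and [e ^ m.-1] at [alpha x], so the claim becomes
     [em1]. *)
  have -> : pos x %% m = m.-1.
    by apply/eqP; rewrite eqn_leq -[in X in X && _]ltnS prednK // ltn_pmod //= -ltnS prednK.
  by rewrite subnn subn0 prednK.
exists y; split=> //.
  apply/permP=> x; rewrite -(permKV alpha x); set z := (alpha^-1)%g x.
  rewrite permJ yX permE /f (alphaX_mod (c z) (c (alpha z) * e)) //.
  by rewrite -!permM -expgS -expgSr.
(* A cycle length k divides [r] since [y ^+ r = 1]. Conversely y^k fixes [x], so m r divides m c(x)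
   k, and coprimality gives r | k. *)
move=> _ /imsetP[x _ ->]; apply/eqP; rewrite eqn_dvd; apply/andP; split.
  rewrite porbitE; apply: dvdn_trans (dvdn_orbit _ _ _) _.
  by rewrite -orderE order_dvdn y_r.
have := iter_porbit y x; rewrite -permX yX => /eqP.
by rewrite alphaX_fix nE dvdn_pmul2l // Gauss_dvdr.
Qed.

Lemma expgz_modz (gT : finGroupType) (y : gT) (e : int) (r : nat) :
  0 < r -> (y ^+ r = 1)%g -> expgz y e = (y ^+ `|(e %% r)%Z|)%g.
Proof.
move=> r_gt0 y_r; case: e => k /=; first by rewrite modz_nat /= expg_mod.
set t := `|_|.
apply/eqP; rewrite eq_sym eq_mulgV1 invgK -expgD -(expg_mod _ y_r).
(* For the exponent -(k+1), the claim has become y^(t+k+1) = 1. *)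
suff /eqP-> : r %| t + k.+1 by rewrite expg0.
have tE : (t%:Z = (Negz k %% r)%Z)%R by rewrite gez0_abs // modz_ge0 // -lt0n.
have : (t%:Z == Negz k %[mod r])%Z by rewrite tE modz_mod.
by rewrite eqz_mod_dvd NegzE GRing.opprK.
Qed.

Theorem theorem2p8 :
  (forall (e : int) (n r : nat), admissible e n r ->
     forall alpha : 'S_n, cyclic_perm n alpha ->
       exists y : 'S_n,
         [/\ alpha \oS y \oS alpha^-1%g = expgz y e,
             y <> 1%g,
             all_cycles_of_length r y
           & (y ^+ r)%g = 1%g])
  /\ [/\ admissible 2%:Z 6 3,
         admissible 2%:Z 20 5,
         admissible 2%:Z 21 7
       & admissible 2%:Z 60 15]
  /\ admissible (- 2%:Z)%R 55 11.
Proof.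
(* The numerical examples hold by computation. *)
split; last by [].
move=> e n r [_ n_ge3 r_ge2 r_dv_n e_n] alpha alpha_cyc.
have r_gt0 := ltnW r_ge2; have n_gt0 : 0 < n by apply: ltn_trans n_ge3.
pose t := `|(e %% r)%Z|.
have t_m : t ^ (n %/ r) = 1 %[mod r].
  apply/eqP; rewrite -eqz_nat -!modz_nat -natz GRing.natrX natz.
  rewrite gez0_abs; last by rewrite modz_ge0 // -lt0n.
  by rewrite modzXm eqz_mod_dvd.
have := conjugate_power_solution _ alpha t r; rewrite card_ord.
case=> // y [y_alpha y_cyc y_r]; exists y; split=> //.
(* Read left to right, the composite is [alpha^-1 * y * alpha], the conjugate [y ^ alpha]. *)
- by rewrite (expgz_modz _ _ e r r_gt0 y_r) -y_alpha /perm_comp.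
(* Orbit sizes of the identity divide its order 1, against [r_ge2]. *)
- move=> y1; pose x := Ordinal n_gt0.
  have : #|porbit y x| = r by apply: y_cyc; apply: imset_f.
  rewrite y1 porbitE => r_card.
  have := dvdn_orbit 'P <[1%g : 'S_n]> x.
  by rewrite r_card -orderE order1 dvdn1 => /eqP r1; rewrite r1 in r_ge2.
Qed.
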